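(* Let $P=(X,\prec)$ be a poset on $|X|\ge 2$ elements and fix a nonempty subset $A\subseteq X$. Let $f$ be a uniformly random linear extension of $P$ and let $f_{\min}(A):=\min\{f(a):a\in A\}$. Then $$\mathbb{P}[f_{\min}(A)>1]^2\ \ge\ \mathbb{P}[f_{\min}(A)>2]$$ and $$\mathbb{P}[f_{\min}(A)=1]\cdot\mathbb{P}[f_{\min}(A)>1]\ \le\ \mathbb{P}[f_{\min}(A)=2].$$
   Context: A linear extension of a poset $P=(X,\prec)$ with $|X|=n$ is a bijection $f:X\to\{1,\dots,n\}$ such that $u\prec v$ implies $f(u)<f(v)$. Probabilities are with respect to the uniform distribution on the set of linear extensions of $P$. *)

(* Defs.v *)
From mathcomp Require Import all_boot all_order all_algebra.

Set Implicit Arguments.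
Unset Strict Implicit.
Unset Printing Implicit Defensive.

Import Order.TTheory GRing.Theory Num.Theory.

Section LinearExtensions.

Variables (d : Order.disp_t) (X : finPOrderType d).

(* {1, ..., n} is encoded as 'I_n through i |-> i.+1. *)
Definition bijectiveb (f : {ffun X -> 'I_#|X|}) : bool :=
  injectiveb f && [forall i, exists x, f x == i].

Definition lin_ext : {set {ffun X -> 'I_#|X|}} :=
  [set f | bijectiveb f &&
           [forall u, forall v, (u < v)%O ==> (f u < f v)%N]].

Definition pos (f : {ffun X -> 'I_#|X|}) (x : X) : nat := (f x).+1.

(* The default value #|X| is an upper bound of pos f, so for A nonempty this
   is the minimum of pos f over A. *)
Definition fmin (A : {set X}) (f : {ffun X -> 'I_#|X|}) : nat :=
  \big[minn/#|X|]_(a in A) pos f a.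

Definition Pr (E : pred {ffun X -> 'I_#|X|}) : rat :=
  (#|[set f in lin_ext | E f]|%:R / #|lin_ext|%:R)%R.

End LinearExtensions.

(* Main.v *)
Require Import Defs.
From mathcomp Require Import all_boot all_order all_algebra.
From mathcomp Require Import ring lra.

Set Implicit Arguments.
Unset Strict Implicit.
Unset Printing Implicit Defensive.

Import Order.TTheory GRing.Theory Num.Theory.

(* Both inequalities say N_2 N_0 <= N_1^2, where N_k is the number of linear
   extensions with f_min(A) > k.  Reading a linear extension as a word, counting
   by the first two letters x, y defines a symmetric bilinear form M on
   functions of the minimal elements: a word with y minimal contributes to the
   entry (x, y), a word with y not minimal (x is then its only predecessor) to
   the entry (x, x).  If v is the indicator of the complement of A, then
   N_0 = M(1, 1), N_1 = M(v, 1) and N_2 <= M(v, v), so it suffices that M is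
   hyperbolic: M(v, v) M(1, 1) <= M(v, 1)^2 for all v.

   This is proved by induction on the poset, in the style of the combinatorial
   atlases of Chan and Pak.  Removing a minimal element x transports v to a
   function v_x on the minimal elements of P - x, with (M v)_x = M_x(v_x, 1) and
   (M 1)_x = M_x(1, 1).  The induction hypothesis gives
     sum_x (M v)_x^2 / (M 1)_x >= sum_x M_x(v_x, v_x) >= M(v, v),
   where the last step compares the contributions of the first three letters.
   A spectral argument turns this inequality into hyperbolicity of M. *)

Local Open Scope ring_scope.

Lemma sum3_rotate (V : nmodType) (T : finType) (F : T -> T -> T -> V) :
  \sum_x \sum_y \sum_z F x y z = \sum_x \sum_y \sum_z F y z x.
Proof.
by rewrite [RHS]exchange_big; apply: eq_bigr => x _; rewrite [RHS]exchange_big.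
Qed.

Lemma sum2_ge0_of_symmetrized (R : realDomainType) (T : finType)
    (F : T -> T -> R) :
  (forall x y, 0 <= F x y + F y x) -> 0 <= \sum_x \sum_y F x y.
Proof.
move=> Fge0; rewrite -(pmulrn_lge0 _ (ltn0Sn 1)) mulr2n {2}exchange_big.
rewrite -big_split sumr_ge0 // => x _.
by rewrite -big_split sumr_ge0 // => y _; apply: Fge0.
Qed.

Lemma fredholm_alternative (F : fieldType) (T U : finType)
    (L : T -> U -> F) (u : T -> F) :
    (forall c, (forall y, \sum_x c x * L x y = 0) -> \sum_x c x * u x = 0) ->
  exists w, forall x, \sum_y L x y * w y = u x.
Proof.
move=> u_orth.
have sum_enum_val (I : finType) (G : I -> F) :
    \sum_(i < #|I|) G (enum_val i) = \sum_x G x.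
  by rewrite -big_enum_val; apply: eq_bigl.
pose A := \matrix_(j < #|U|, i < #|T|) L (enum_val i) (enum_val j).
pose b := \row_(i < #|T|) u (enum_val i).
have /submxP[w bE] : (b <= A)%MS.
  rewrite submxE; apply/eqP/matrixP => i k; rewrite !mxE.
  rewrite -[RHS](u_orth (fun x => cokermx A (enum_rank x) k)) => [|y].
    rewrite -[RHS]sum_enum_val; apply: eq_bigr => j _.
    by rewrite mxE enum_valK mulrC.
  have /matrixP/(_ (enum_rank y) k) := mulmx_coker A; rewrite !mxE => AK.
  rewrite -[RHS]AK -[LHS]sum_enum_val; apply: eq_bigr => j _.
  by rewrite !mxE enum_rankK enum_valK mulrC.
exists (fun y => w 0 (enum_rank y)) => x.
have /matrixP/(_ 0 (enum_rank x)) := bE; rewrite !mxE enum_rankK => ->.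
rewrite -[LHS]sum_enum_val; apply: eq_bigr => j _.
by rewrite !mxE enum_rankK enum_valK mulrC.
Qed.

Section WeightedGraph.

Variables (R : realFieldType) (T : finType) (N : T -> T -> R).
Implicit Types (u v w : T -> R).

Definition degree x : R := \sum_y N x y.

Definition neighbor_sum v x : R := \sum_y N x y * v y.

Definition form v w : R := \sum_x v x * neighbor_sum w x.

Definition laplacian v x : R := degree x * v x - neighbor_sum v x.

Definition hyperbolic : Prop :=
  forall v, form v v * form (fun=> 1) (fun=> 1) <= form v (fun=> 1) ^+ 2.

(* On isolated vertices the summand is 0 / 0 = 0. *)
Definition contractive : Prop :=
  forall v, form v v <= \sum_x neighbor_sum v x ^+ 2 / degree x.

Definition connected_support : Prop :=
  forall x y, degree x != 0 -> degree y != 0 ->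
    connect (fun s t => N s t != 0) x y.

Hypothesis Nsym : forall x y, N x y = N y x.

Lemma form_sym v w : form v w = form w v.
Proof.
rewrite /form /neighbor_sum; under eq_bigr do rewrite mulr_sumr.
rewrite exchange_big /=; apply: eq_bigr => x _; rewrite mulr_sumr.
by apply: eq_bigr => y _; rewrite Nsym; ring.
Qed.

Lemma formBl u v w : form (fun x => u x - v x) w = form u w - form v w.
Proof. by rewrite /form -sumrB; apply: eq_bigr => x _; rewrite mulrBl. Qed.

Lemma formBr u v w : form w (fun x => u x - v x) = form w u - form w v.
Proof. by rewrite form_sym formBl !(form_sym w). Qed.

Lemma formZl c v w : form (fun x => c * v x) w = c * form v w.
Proof. by rewrite /form mulr_sumr; apply: eq_bigr => x _; rewrite mulrA. Qed.

Lemma formZr c v w : form v (fun x => c * w x) = c * form v w.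
Proof. by rewrite form_sym formZl form_sym. Qed.

Lemma neighbor_sum1 x : neighbor_sum (fun=> 1) x = degree x.
Proof. by apply: eq_bigr => y _; rewrite mulr1. Qed.

Lemma form1r v : form v (fun=> 1) = \sum_x v x * degree x.
Proof. by apply: eq_bigr => x _; rewrite neighbor_sum1. Qed.

Lemma hyperbolic_of_nonpos_on_orthogonal :
    0 <= form (fun=> 1) (fun=> 1) ->
    (forall v, form v (fun=> 1) = 0 -> form v v <= 0) ->
  hyperbolic.
Proof.
move=> m_ge0 nonpos v; set one := (fun=> 1) : T -> R.
have [->|m_neq0] := eqVneq (form one one) 0; first by rewrite mulr0 sqr_ge0.
pose c := form v one / form one one.
pose v0 x := v x - c * one x.
have v0_orth : form v0 one = 0 by rewrite formBl formZl divfK ?subrr.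
have vvE : form v v = form v0 v0 + c ^+ 2 * form one one.
  rewrite [form v0 v0]formBr formZr v0_orth mulr0 subr0 formBl formZl.
  by rewrite (form_sym one v) /c; field.
have -> : form v one = c * form one one by rewrite divfK.
rewrite vvE mulrDl -mulrA -expr2 -exprMn gerDr.
exact: mulr_le0_ge0 (nonpos _ v0_orth) m_ge0.
Qed.

Lemma dirichlet_energy v :
  (\sum_x v x * laplacian v x) *+ 2 = \sum_x \sum_y N x y * (v x - v y) ^+ 2.
Proof.
have energyE : \sum_x v x * laplacian v x
    = \sum_x \sum_y N x y * (v x ^+ 2 - v x * v y).
  apply: eq_bigr => x _; rewrite /laplacian mulr_suml -sumrB mulr_sumr.
  by apply: eq_bigr => y _; ring.
rewrite mulr2n energyE {1}exchange_big -big_split; apply: eq_bigr => x _.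
by rewrite -big_split; apply: eq_bigr => y _ /=; rewrite Nsym; ring.
Qed.

Hypothesis Nge0 : forall x y, 0 <= N x y.

Lemma degree_ge0 x : 0 <= degree x.
Proof. exact: sumr_ge0. Qed.

Lemma neighbor_sum_isolated v x : degree x = 0 -> neighbor_sum v x = 0.
Proof.
move=> /psumr_eq0P Nx0; rewrite /neighbor_sum big1 // => y _.
by rewrite Nx0 ?mul0r.
Qed.

Lemma eq_form_support v v' w :
  (forall x, degree x != 0 -> v x = v' x) -> form v w = form v' w.
Proof.
move=> vv'; apply: eq_bigr => x _.
have [/neighbor_sum_isolated->|/vv'->//] := eqVneq (degree x) 0.
by rewrite !mulr0.
Qed.

Lemma form_le_degree v : form v v <= \sum_x degree x * v x ^+ 2.
Proof.
have energy_ge0 : 0 <= \sum_x v x * laplacian v x.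
  rewrite -(pmulrn_lge0 _ (ltn0Sn 1)) dirichlet_energy.
  by do 2!(apply: sumr_ge0 => ? _); rewrite mulr_ge0 ?sqr_ge0.
rewrite -subr_ge0 -sumrB (le_trans energy_ge0) //.
by apply: ler_sum => x _; rewrite /laplacian; lra.
Qed.

Lemma harmonic_constant v x y :
    (forall z, laplacian v z = 0) ->
  connect (fun s t => N s t != 0) x y -> v x = v y.
Proof.
move=> v_harmonic.
have /psumr_eq0P energy0 : \sum_s \sum_t N s t * (v s - v t) ^+ 2 = 0.
  by rewrite -dirichlet_energy big1 ?mul0rn // => s _; rewrite v_harmonic mulr0.
have v_edge s t : N s t != 0 -> v s = v t.
  move=> Nst; have term_ge0 s' t' : 0 <= N s' t' * (v s' - v t') ^+ 2.
    by rewrite mulr_ge0 ?sqr_ge0.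
  have /psumr_eq0P/(_ t isT)/eqP : \sum_t' N s t' * (v s - v t') ^+ 2 = 0.
    by apply: energy0 => // s' _; apply: sumr_ge0.
  by rewrite mulf_eq0 (negPf Nst) sqrf_eq0 subr_eq0 => /(_ _)/eqP ->.
case/connectP => p; elim: p x => [|z p IHp] x /= => [_ -> //|/andP[/v_edge-> ]].
exact: IHp.
Qed.

Lemma laplacian_surjective u :
    connected_support ->
    (forall x, degree x = 0 -> u x = 0) -> \sum_x u x = 0 ->
  exists w, forall x, laplacian w x = u x.
Proof.
move=> N_conn u_supp u_sum0.
pose L x y : R := (x == y)%:R * degree x - N x y.
have LE w x : \sum_y L x y * w y = laplacian w x.
  under eq_bigr do rewrite mulrBl; rewrite sumrB; congr (_ - _).
  rewrite (bigD1 x) //= eqxx mul1r big1 ?addr0 // => y.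
  by rewrite eq_sym => /negPf ->; rewrite !mul0r.
have Lsym x y : L x y = L y x.
  by rewrite /L Nsym eq_sym; case: eqP => [->|_] //; rewrite !mul0r.
suff u_orth c : (forall y, \sum_x c x * L x y = 0) -> \sum_x c x * u x = 0.
  by have [w wE] := fredholm_alternative u_orth; exists w => x; rewrite -LE.
move=> c_ker; have c_harmonic x : laplacian c x = 0.
  by rewrite -LE -[RHS](c_ker x); apply: eq_bigr => y _; rewrite Lsym mulrC.
have [x0 x0P|no_edge] := pickP (fun x => degree x != 0); last first.
  by apply: big1 => x _; rewrite u_supp ?mulr0 //; apply/eqP/negbFE/no_edge.
transitivity (c x0 * \sum_x u x); last by rewrite u_sum0 mulr0.
rewrite mulr_sumr; apply: eq_bigr => x _.
have [/u_supp->|xP] := eqVneq (degree x) 0; first by rewrite !mulr0.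
by rewrite (harmonic_constant c_harmonic (N_conn x x0 xP x0P)).
Qed.

(* Let K be the operator v |-> neighbor_sum v / degree, self-adjoint for the
   inner product weighted by the degrees.  The contraction hypothesis says
   K <= K^2, so K has no eigenvalue in (0, 1), and connectedness makes the
   eigenvalue 1 simple; hence K <= 0 on the orthogonal of 1.  The spectral
   theorem is avoided by solving v = (1 - K) w there: then
   <v, K v> = <w, K w> - 2 <K w, K w> + <K w, K K w> <= 0, since K <= 1. *)
Lemma contractive_nonpos_on_orthogonal v :
    connected_support -> contractive ->
  form v (fun=> 1) = 0 -> form v v <= 0.
Proof.
move=> N_conn contr; rewrite form1r => v_orth.
have [|w wE] := @laplacian_surjective (fun x => v x * degree x) N_conn _ v_orth.
  by move=> x ->; rewrite mulr0.
pose kw x := neighbor_sum w x / degree x.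
have vE x : degree x != 0 -> v x = w x - kw x.
  move=> dx; apply: (mulIf dx); rewrite -wE /laplacian /kw; field.
  exact: dx.
have kw_w : form kw w = \sum_x neighbor_sum w x ^+ 2 / degree x.
  by apply: eq_bigr => x _; rewrite /kw; ring.
have kw_kw : \sum_x degree x * kw x ^+ 2 = form kw w.
  apply: eq_bigr => x _; rewrite /kw; have [dx|dx] := eqVneq (degree x) 0.
    by rewrite neighbor_sum_isolated //; ring.
  by field.
rewrite (eq_form_support _ vE) form_sym (eq_form_support _ vE).
rewrite formBl !formBr (form_sym w kw).
by have := contr w; have := form_le_degree kw; rewrite kw_kw -kw_w; lra.
Qed.

Lemma hyperbolic_of_contractive :
  connected_support -> contractive -> hyperbolic.
Proof.
move=> N_conn contr; apply: hyperbolic_of_nonpos_on_orthogonal => [|v].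
  by rewrite form1r sumr_ge0 // => x _; rewrite mul1r degree_ge0.
exact: contractive_nonpos_on_orthogonal.
Qed.

End WeightedGraph.

Section FeasibleWords.

Variables (d : Order.disp_t) (X : finPOrderType d).
Implicit Types (S A : {set X}) (p : seq X) (E : pred (seq X)).

Definition minimal S x := (x \in S) && [forall y in S, ~~ (y < x)%O].

(* Feasible words are the initial segments of linear extensions of S. *)
Fixpoint feasible S p :=
  if p is x :: p' then minimal S x && feasible (S :\ x) p' else true.

Lemma minimalP S x :
  reflect (x \in S /\ forall y, y \in S -> ~~ (y < x)%O) (minimal S x).
Proof.
apply: (iffP andP) => [] [xS xmin]; split=> //; last exact/forall_inP.
by move=> y; apply/forall_inP: y.
Qed.

Lemma minimal_in S x : minimal S x -> x \in S.
Proof. by case/minimalP. Qed.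

Lemma card_minimal S x : minimal S x -> #|S| = #|S :\ x|.+1.
Proof. by move=> xmin; rewrite (cardsD1 x) (minimal_in xmin). Qed.

Lemma minimal_setD11 S x : minimal (S :\ x) x = false.
Proof. by rewrite /minimal setD11. Qed.

Lemma minimal_set1 x y : minimal [set x] y = (y == x).
Proof.
rewrite /minimal inE andb_idr // => /eqP ->.
by apply/forall_inP => z; rewrite inE => /eqP ->; rewrite ltxx.
Qed.

Lemma minimal_setD1 S x y : x != y -> minimal S x -> minimal (S :\ y) x.
Proof.
move=> xy /minimalP[xS xmin]; apply/minimalP; rewrite !inE xy; split=> // z.
by rewrite !inE => /andP[_ /xmin].
Qed.

Lemma minimal_of_setD1s S x y z :
  x != y -> minimal (S :\ x) z -> minimal (S :\ y) z -> minimal S z.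
Proof.
move=> xy /minimalP[+ xmin] /minimalP[_ ymin]; rewrite !inE => /andP[zx zS].
apply/minimalP; split=> // t tS; have [tx|tx] := eqVneq t x.
  by apply: ymin; rewrite !inE tx xy -tx.
by apply: xmin; rewrite !inE tx.
Qed.

Lemma minimal_exists S : S != set0 -> exists x, minimal S x.
Proof.
case/set0Pn => x0 x0S.
case: (arg_minnP (fun x => #|[set y in S | (y < x)%O]|) x0S) => x xS below_min.
exists x; apply/minimalP; split=> // y yS; apply/negP => yx.
have := below_min y yS; rewrite leqNgt => /negP; apply.
apply/proper_card/properP; split; last by exists y; rewrite !inE yS ?yx // ltxx.
by apply/subsetP => z; rewrite !inE => /andP[-> /lt_trans->].
Qed.

Lemma setD1C S x y : S :\ x :\ y = S :\ y :\ x.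
Proof. by apply/setP => z; rewrite !inE andbCA. Qed.

Lemma feasibleP S p :
  reflect
    [/\ uniq p, {subset p <= S}
      & forall x y, x \in S -> y \in p -> (x < y)%O ->
          (index x p < index y p)%N]
    (feasible S p).
Proof.
elim: p S => [|a p IHp] S /=; first by apply: ReflectT; split.
apply: (iffP andP).
- move=> [amin /IHp[p_uniq pS p_mono]].
  have ap : a \notin p by apply/negP => /pS; rewrite !inE eqxx.
  case/minimalP: amin => aS amin; split=> [|x|x y xS]; first by rewrite ap.
    by rewrite inE => /predU1P[->//|/pS]; rewrite inE => /andP[].
  rewrite inE => /predU1P[->|yp] xy; first by rewrite (negPf (amin x xS)) in xy.
  rewrite (negPf (_ : a != y)); last by apply: contraNneq ap => ->.
  by have [//|xa] := eqVneq a x; apply: p_mono; rewrite // !inE eq_sym xa.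
- move=> [/andP[ap p_uniq] apS p_mono]; split.
    apply/minimalP; split=> [|y yS]; first by rewrite apS ?mem_head.
    by apply/negP => ya; have := p_mono y a yS (mem_head _ _) ya; rewrite eqxx.
  apply/IHp; split=> // [x xp|x y].
    by rewrite !inE (memPn ap) ?apS // inE xp orbT.
  rewrite !inE => /andP[xa xS] yp xy.
  have := p_mono x y xS; rewrite inE yp orbT eq_sym (negPf xa) => /(_ isT xy).
  by case: eqP => // ay; rewrite ay yp in ap.
Qed.

Definition num_words n S E := #|[set p : n.-tuple X | feasible S p && E p]|.

Definition num_ext n S := num_words n S predT.

Lemma num_wordsS n S E :
  num_words n.+1 S E =
    (\sum_(x | minimal S x) num_words n (S :\ x) (fun p => E (x :: p)))%N.
Proof.
rewrite /num_words -sum1_card big_mkcond.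
have cons_bij : bijective (fun xt : X * n.-tuple X => [tuple of xt.1 :: xt.2]).
  exists (fun t => (thead t, [tuple of behead t])) => [[x t]|t].
    by rewrite theadE; congr (_, _); apply: val_inj.
  by rewrite [RHS]tuple_eta.
rewrite (reindex _ (onW_bij _ cons_bij)).
rewrite -(pair_bigA _ (fun x (t : n.-tuple X) =>
                         if [tuple of x :: t] \in _ then 1 else 0)%N).
rewrite [RHS]big_mkcond; apply: eq_bigr => x _; case: ifPn => xmin.
  rewrite -sum1_card [RHS]big_mkcond; apply: eq_bigr => t _.
  by rewrite !inE /= xmin.
by rewrite big1 // => t _; rewrite inE /= (negPf xmin).
Qed.

Lemma num_extS n S :
  num_ext n.+1 S = (\sum_(x | minimal S x) num_ext n (S :\ x))%N.
Proof. exact: num_wordsS. Qed.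

Lemma eq_num_words n S E E' : E =1 E' -> num_words n S E = num_words n S E'.
Proof. by move=> EE'; apply: eq_card => t; rewrite !inE EE'. Qed.

Lemma num_words_guard n S (b : bool) E :
  num_words n S (fun p => b && E p) = (b * num_words n S E)%N.
Proof.
case: b; first by rewrite mul1n.
by apply: eq_card0 => t; rewrite inE andbF.
Qed.

Lemma num_ext0 S : num_ext 0 S = 1%N.
Proof.
by apply/eqP/cards1P; exists [tuple]; apply/setP => t; rewrite !inE tuple0 eqxx.
Qed.

Lemma num_ext_gt0 n S : (n <= #|S|)%N -> (0 < num_ext n S)%N.
Proof.
elim: n S => [|n IHn] S nS; first by rewrite num_ext0.
have [x xmin] : exists x, minimal S x.
  by apply: minimal_exists; rewrite -card_gt0 (leq_trans _ nS).
rewrite num_extS (bigD1 x) //= addn_gt0 IHn //.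
by rewrite (card_minimal xmin) in nS.
Qed.

Definition avoids A k p := all [predC A] (take k p).

Lemma num_words_avoids0 n S A : num_words n S (avoids A 0) = num_ext n S.
Proof. by apply: eq_num_words => p; rewrite /avoids take0. Qed.

Lemma num_words_avoidsS n S A k :
  num_words n.+1 S (avoids A k.+1) =
    (\sum_(x | minimal S x) (x \notin A) * num_words n (S :\ x) (avoids A k))%N.
Proof.
by rewrite num_wordsS; apply: eq_bigr => x _; rewrite -num_words_guard.
Qed.

End FeasibleWords.

Section PairWeight.

Variables (R : realFieldType) (d : Order.disp_t) (X : finPOrderType d).
Implicit Types (S A : {set X}) (v : X -> R).

Definition unlocks S x z := minimal (S :\ x) z && ~~ minimal S z.

(* For #|S| = n.+2, linear extensions of S are counted by their first two
   letters x, y; when y is not minimal in S, x is its only predecessor and the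
   pair is recorded as (x, x), which makes the weight symmetric. *)
Definition pair_weight n S x y : R :=
  if minimal S x then
    if x == y then \sum_(z | unlocks S x z) (num_ext n (S :\ x :\ z))%:R
    else if minimal S y then (num_ext n (S :\ x :\ y))%:R else 0
  else 0.

(* Once x is removed, the elements that x unlocks inherit its value. *)
Definition inherit S x v y : R := if minimal S y then v y else v x.

Lemma pair_weight_sym n S x y : pair_weight n S x y = pair_weight n S y x.
Proof.
rewrite /pair_weight [y == x]eq_sym; case: (eqVneq x y) => [->//|_].
by rewrite setD1C; do 2!case: minimal.
Qed.

Lemma pair_weight_ge0 n S x y : 0 <= pair_weight n S x y.
Proof.
by rewrite /pair_weight; do 3?case: ifP => // _; rewrite ?ler0n ?sumr_ge0.
Qed.

Lemma neighbor_sum_pair_weight n S v x : neighbor_sum (pair_weight n S) v x =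
  if minimal S x
  then \sum_(y | minimal (S :\ x) y)
         inherit S x v y * (num_ext n (S :\ x :\ y))%:R
  else 0.
Proof.
rewrite /neighbor_sum /pair_weight; case: ifP => xmin; last first.
  by rewrite big1 // => y _; rewrite mul0r.
rewrite (bigD1 x) //= eqxx [RHS](bigID (minimal S)) /= addrC; congr (_ + _).
  rewrite big_mkcond [RHS]big_mkcond; apply: eq_bigr => y _ /=.
  have [->|yx] := eqVneq y x; first by rewrite minimal_setD11.
  rewrite /= /inherit; have [ymin|] := boolP (minimal S y).
    by rewrite (minimal_setD1 yx ymin) mulrC.
  by rewrite andbF mul0r.
rewrite mulr_suml; apply: eq_bigr => y /andP[_ /negPf ymin].
by rewrite /inherit ymin mulrC.
Qed.

Lemma degree_pair_weight n S x : degree (pair_weight n S) x =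
  if minimal S x then (num_ext n.+1 (S :\ x))%:R else 0.
Proof.
rewrite -neighbor_sum1 neighbor_sum_pair_weight; case: ifP => // _.
rewrite num_extS natr_sum; apply: eq_bigr => y _.
by rewrite /inherit if_same mul1r.
Qed.

Lemma form_pair_weight n S v w : form (pair_weight n S) v w =
  \sum_(x | minimal S x) \sum_(y | minimal (S :\ x) y)
     v x * inherit S x w y * (num_ext n (S :\ x :\ y))%:R.
Proof.
rewrite [RHS]big_mkcond; apply: eq_bigr => x _.
rewrite neighbor_sum_pair_weight; case: ifP => _; last by rewrite mulr0.
by rewrite mulr_sumr; apply: eq_bigr => y _; rewrite mulrA.
Qed.

Lemma form_pair_weight1 n S v : form (pair_weight n S) v (fun=> 1) =
  \sum_(x | minimal S x) v x * (num_ext n.+1 (S :\ x))%:R.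
Proof.
rewrite form1r [RHS]big_mkcond; apply: eq_bigr => x _.
by rewrite degree_pair_weight; case: ifP; rewrite ?mulr0.
Qed.

Lemma pair_weight_connected n S :
  (n.+2 <= #|S|)%N -> connected_support (pair_weight n S).
Proof.
move=> nS x y; rewrite !degree_pair_weight.
case: ifP => [xmin _|]; last by rewrite eqxx.
case: ifP => [ymin _|]; last by rewrite eqxx.
have [->//|xy] := eqVneq x y; apply/connect1.
rewrite /pair_weight xmin ymin (negPf xy) pnatr_eq0 -lt0n num_ext_gt0 //.
have yx_min : minimal (S :\ x) y by rewrite minimal_setD1 // eq_sym.
by rewrite (card_minimal xmin) (card_minimal yx_min) in nS.
Qed.

Section FirstThreeLetters.

Variables (n : nat) (S : {set X}) (v : X -> R).

(* The contribution of the first three letters x, y, z to the right-hand side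
   minus the left-hand side of form_pair_weight_pullback. *)
Definition pullback_gain x y z : R :=
  (feasible S [:: x; y; z])%:R
    * (inherit S x v y * (inherit (S :\ x) y (inherit S x v) z - v x)).

Definition antichain_term x y z : R :=
  [&& minimal S x, minimal S y, minimal S z, x != y, y != z & x != z]%:R
    * (v y * (v z - v x)).

Definition chain_term x y z : R :=
  [&& minimal S x, minimal S z, x != z & unlocks S x y]%:R
    * (v x * (v x - v z)).

Definition join_term x y z : R :=
  [&& minimal S x, minimal S y, x != y, minimal (S :\ x :\ y) z,
      ~~ minimal (S :\ x) z & ~~ minimal (S :\ y) z]%:R * (v y * (v y - v x)).

Let weight x y z : R := (num_ext n (S :\ x :\ y :\ z))%:R.

(* Three shapes contribute: x, y, z pairwise incomparable, which cancels when x
   and z are swapped; a relation x < y with z incomparable to both, which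
   cancels against the word z, x, y; and z above both x and y, which together
   with the word y, x, z leaves (v x - v y)^2. *)
Lemma pullback_gainE x y z :
  pullback_gain x y z
    = antichain_term x y z + (chain_term y z x - chain_term x y z)
      + join_term x y z.
Proof.
rewrite /pullback_gain /antichain_term /chain_term /join_term.
rewrite /inherit /unlocks /= andbT.
have [xmin|] := boolP (minimal S x); last by rewrite ?andbF /=; lra.
have [<-|xy] := eqVneq x y.
  by rewrite !minimal_setD11 ?andbF /=; lra.
have [ymin|ymin] := boolP (minimal S y); last first.
  have [yx|] := boolP (minimal (S :\ x) y); last by rewrite ?andbF /=; lra.
  have [zmin|_] := boolP (minimal S z); last by rewrite !if_same ?andbF /=; lra.
  have [<-|xz] := eqVneq x z.
    by rewrite setD1C !minimal_setD11 /=; lra.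
  have zy : z != y by apply: contraNneq ymin => <-.
  have zx : minimal (S :\ x) z by rewrite minimal_setD1 // eq_sym.
  by rewrite zx minimal_setD1 //=; lra.
rewrite (minimal_setD1 _ ymin) 1?eq_sym //=.
have [<-|xz] := eqVneq x z.
  by rewrite setD1C !minimal_setD11 xmin ?andbF /=; lra.
have [<-|yz] := eqVneq y z.
  by rewrite !minimal_setD11 ymin ?andbF /=; lra.
have [zmin|zmin] := boolP (minimal S z).
  by rewrite !(minimal_setD1 _ _) 1?eq_sym // ?andbF /=; lra.
have [zx|zx] := boolP (minimal (S :\ x) z).
  by rewrite (negPf (contra (minimal_of_setD1s xy zx) zmin)) ?andbF /=; lra.
have [zy|zy] := boolP (minimal (S :\ y) z).
  by rewrite setD1C (minimal_setD1 _ zy) 1?eq_sym //=; lra.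
by rewrite ?andbF !andbT /=; lra.
Qed.

Lemma antichain_term_swap x y z : antichain_term z y x = - antichain_term x y z.
Proof.
rewrite /antichain_term (eq_sym z y) (eq_sym y x) (eq_sym z x) -!mulrN opprB.
congr (_%:R * _); rewrite [X in [&& _, _, _ & X]]andbCA.
by do 3!case: (minimal S _).
Qed.

Lemma join_term_symmetrized_ge0 x y z : 0 <= join_term x y z + join_term y x z.
Proof.
rewrite /join_term (setD1C S y x) (eq_sym y x).
have -> : [&& minimal S y, minimal S x, x != y, minimal (S :\ x :\ y) z,
    ~~ minimal (S :\ y) z & ~~ minimal (S :\ x) z]
  = [&& minimal S x, minimal S y, x != y, minimal (S :\ x :\ y) z,
    ~~ minimal (S :\ x) z & ~~ minimal (S :\ y) z].
  by rewrite andbCA; do 4!congr (_ && _); rewrite andbC.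
rewrite -mulrDr mulr_ge0 ?ler0n //.
have -> : v y * (v y - v x) + v x * (v x - v y) = (v x - v y) ^+ 2 by ring.
exact: sqr_ge0.
Qed.

Let weight_swap12 x y z : weight x y z = weight y x z.
Proof. by rewrite /weight (setD1C S x y). Qed.

Let weight_swap23 x y z : weight x y z = weight x z y.
Proof. by rewrite /weight (setD1C (S :\ x) y z). Qed.

Lemma sum_antichain_term_ge0 :
  0 <= \sum_x \sum_y \sum_z antichain_term x y z * weight x y z.
Proof.
rewrite exchange_big /= sumr_ge0 // => y _.
apply: sum2_ge0_of_symmetrized => x z.
rewrite (weight_swap12 z) (weight_swap23 y) -(weight_swap12 x) -mulrDl.
by rewrite antichain_term_swap addNr mul0r.
Qed.

Lemma sum_join_term_ge0 :
  0 <= \sum_x \sum_y \sum_z join_term x y z * weight x y z.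
Proof.
apply: sum2_ge0_of_symmetrized => x y.
rewrite -big_split sumr_ge0 //= => z _.
by rewrite (weight_swap12 y) -mulrDl mulr_ge0 ?join_term_symmetrized_ge0.
Qed.

Lemma sum_chain_term_rotate :
  \sum_x \sum_y \sum_z chain_term y z x * weight x y z
    = \sum_x \sum_y \sum_z chain_term x y z * weight x y z.
Proof.
rewrite [RHS]sum3_rotate; do 3!apply: eq_bigr => ? _.
by rewrite [in RHS]weight_swap23 [in RHS]weight_swap12.
Qed.

Lemma sum_pullback_gain_ge0 :
  0 <= \sum_x \sum_y \sum_z pullback_gain x y z * weight x y z.
Proof.
have -> : \sum_x \sum_y \sum_z pullback_gain x y z * weight x y z
    = \sum_x \sum_y \sum_z antichain_term x y z * weight x y z
      + (\sum_x \sum_y \sum_z chain_term y z x * weight x y z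
         - \sum_x \sum_y \sum_z chain_term x y z * weight x y z)
      + \sum_x \sum_y \sum_z join_term x y z * weight x y z.
  do 3!(rewrite -sumrB -!big_split; apply: eq_bigr => ? _).
  by rewrite pullback_gainE /=; ring.
rewrite sum_chain_term_rotate subrr addr0.
by rewrite addr_ge0 ?sum_antichain_term_ge0 ?sum_join_term_ge0.
Qed.

End FirstThreeLetters.

Lemma form_pair_weight_pullback n S v : form (pair_weight n.+1 S) v v <=
  \sum_(x | minimal S x)
     form (pair_weight n (S :\ x)) (inherit S x v) (inherit S x v).
Proof.
rewrite -subr_ge0; have := sum_pullback_gain_ge0 n S v.
congr (0 <= _); apply/esym.
rewrite form_pair_weight -sumrB big_mkcond; apply: eq_bigr => x _.
rewrite /pullback_gain /=; case: ifP => _; last first.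
  by rewrite big1 // => y _; rewrite big1 // => z _; rewrite !mul0r.
rewrite form_pair_weight -sumrB big_mkcond; apply: eq_bigr => y _.
case: ifP => _ /=; last by rewrite big1 // => z _; rewrite !mul0r.
rewrite num_extS natr_sum mulr_sumr -sumrB big_mkcond; apply: eq_bigr => z _.
by case: ifP => _ /=; [ring | rewrite !mul0r].
Qed.

Lemma pair_weight0_hyperbolic S : #|S| = 2 -> hyperbolic (pair_weight 0 S).
Proof.
move=> S2 v; have [a amin] : exists a, minimal S a.
  by apply: minimal_exists; rewrite -card_gt0 S2.
have /eqP/cards1P[b SaE] : #|S :\ a| = 1.
  by move: S2; rewrite (card_minimal amin) => -[].
have ba : b != a by have := set11 b; rewrite -SaE !inE => /andP[].
have SE : S = [set a; b] by rewrite -SaE setD1K ?minimal_in.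
have SbE : S :\ b = [set a] by rewrite SE setUC setU1K // inE.
have formE (w w' : X -> R) : form (pair_weight 0 S) w w' =
    w a * inherit S a w' b + (if minimal S b then w b * w' a else 0).
  rewrite form_pair_weight (bigD1 a) //= SaE (eq_bigl _ _ (minimal_set1 b)).
  rewrite big_pred1_eq num_ext0 mulr1; congr (_ + _).
  have minimal_neq_a x : minimal S x && (x != a) = minimal S b && (x == b).
    have [->|xb] := eqVneq x b; first by rewrite ba.
    rewrite andbF; apply/andP => -[/minimal_in].
    by rewrite SE !inE (negPf xb) orbF => ->.
  rewrite (eq_bigl _ _ minimal_neq_a).
  case: ifP => bmin; last by rewrite big_pred0.
  rewrite big_pred1_eq SbE (eq_bigl _ _ (minimal_set1 a)) big_pred1_eq.
  by rewrite num_ext0 mulr1 /inherit amin.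
rewrite !formE /inherit; have := sqr_ge0 (v a - v b).
by case: ifP => _; nra.
Qed.

Lemma pair_weight_contractive n S : #|S| = n.+3 ->
    (forall x, minimal S x -> hyperbolic (pair_weight n (S :\ x))) ->
  contractive (pair_weight n.+1 S).
Proof.
move=> Sn hyp v; apply: le_trans (form_pair_weight_pullback n S v) _.
rewrite big_mkcond; apply: ler_sum => x _.
rewrite neighbor_sum_pair_weight degree_pair_weight.
case: ifP => xmin; last by rewrite invr0 mulr0.
rewrite ler_pdivlMr; last first.
  rewrite ltr0n num_ext_gt0 //.
  by move: Sn; rewrite (card_minimal xmin) => -[->].
have := hyp x xmin (inherit S x v); rewrite !form_pair_weight1.
by under [X in _ * X]eq_bigr do rewrite mul1r; rewrite -natr_sum -num_extS.
Qed.

Lemma pair_weight_hyperbolic n S : #|S| = n.+2 -> hyperbolic (pair_weight n S).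
Proof.
elim: n S => [|n IHn] S Sn; first exact: pair_weight0_hyperbolic.
apply: hyperbolic_of_contractive.
- exact: pair_weight_sym.
- exact: pair_weight_ge0.
- by apply: pair_weight_connected; rewrite Sn.
apply: pair_weight_contractive => // x xmin; apply: IHn.
by move: Sn; rewrite (card_minimal xmin) => -[].
Qed.

Lemma num_ext_form n S :
  (num_ext n.+2 S)%:R = form (pair_weight n S) (fun=> 1) (fun=> 1).
Proof.
rewrite form_pair_weight1 num_extS natr_sum.
by apply: eq_bigr => x _; rewrite mul1r.
Qed.

Definition outside A x : R := (x \notin A)%:R.

Lemma num_words_avoids1_form n S A :
  (num_words n.+2 S (avoids A 1))%:R
    = form (pair_weight n S) (outside A) (fun=> 1).
Proof.
rewrite form_pair_weight1 num_words_avoidsS natr_sum.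
by apply: eq_bigr => x _; rewrite num_words_avoids0 natrM.
Qed.

(* Equality fails: a word x, y with x < y, x outside A and y in A is counted
   on the right, where y inherits the value of x. *)
Lemma num_words_avoids2_le_form n S A :
  (num_words n.+2 S (avoids A 2))%:R
    <= form (pair_weight n S) (outside A) (outside A).
Proof.
rewrite form_pair_weight num_words_avoidsS natr_sum; apply: ler_sum => x _.
rewrite num_words_avoidsS big_distrr natr_sum; apply: ler_sum => y _ /=.
rewrite num_words_avoids0 mulnA !natrM ler_wpM2r ?ler0n // /inherit.
by case: ifP => _ //; rewrite -!natrM ler_nat; do 2!case: (_ \in A).
Qed.

End PairWeight.

Lemma num_words_avoids_log_concave (d : Order.disp_t) (X : finPOrderType d)
    n (S A : {set X}) : #|S| = n.+2 ->
  (num_ext n.+2 S * num_words n.+2 S (avoids A 2)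
     <= num_words n.+2 S (avoids A 1) ^ 2)%N.
Proof.
move=> Sn; rewrite -(ler_nat rat) natrM natrX.
rewrite num_ext_form num_words_avoids1_form.
have := pair_weight_hyperbolic Sn (outside rat A).
apply: le_trans; rewrite mulrC ler_wpM2r //.
  by rewrite -num_ext_form.
exact: num_words_avoids2_le_form.
Qed.

Section LinearExtensions.

Variables (d : Order.disp_t) (X : finPOrderType d).
Implicit Types (A : {set X}) (p : seq X) (f : {ffun X -> 'I_#|X|}).

Lemma lin_extP f :
  reflect (injective f /\ forall x y, (x < y)%O -> (f x < f y)%N)
    (f \in lin_ext X).
Proof.
rewrite inE; apply: (iffP andP).
  move=> [/andP[/injectiveP f_inj _] /forallP f_mono]; split=> // x y xy.
  by have /forallP/(_ y)/implyP := f_mono x; apply.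
move=> [f_inj f_mono]; split; last first.
  by apply/forallP => x; apply/forallP => y; apply/implyP/f_mono.
apply/andP; split; first exact/injectiveP.
apply/forallP => i; apply/existsP.
have /codomP[x ->] := inj_card_onto f_inj (eq_leq (card_ord _)) i.
by exists x.
Qed.

(* The default value is irrelevant: only words listing all of X are used. *)
Definition labelling p : {ffun X -> 'I_#|X|} :=
  [ffun x => insubd (enum_rank x) (index x p)].

Lemma labellingE p x :
  x \in p -> size p = #|X| -> labelling p x = index x p :> nat.
Proof. by move=> xp pX; rewrite ffunE insubdK // unfold_in -pX index_mem. Qed.

Lemma feasible_full (p : #|X|.-tuple X) x : feasible setT p -> x \in p.
Proof.
case/feasibleP => p_uniq _ _.
have [//|y _||_ ->] := @uniq_min_size _ p (enum X); rewrite ?mem_enum //.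
by rewrite -cardE size_tuple.
Qed.

Lemma labelling_lin_ext (p : #|X|.-tuple X) :
  feasible setT p -> labelling p \in lin_ext X.
Proof.
move=> p_feas; have labelE x : labelling p x = index x p :> nat.
  by rewrite labellingE ?feasible_full ?size_tuple.
apply/lin_extP; split=> [x y /(congr1 val)|x y xy].
  by rewrite /= !labelE => /index_inj ->; rewrite ?feasible_full.
have [_ _ p_mono] := feasibleP _ _ p_feas.
by rewrite !labelE p_mono ?inE ?feasible_full.
Qed.

Lemma lin_ext_labelling f : f \in lin_ext X ->
  exists2 p : #|X|.-tuple X, feasible setT p & labelling p = f.
Proof.
case/lin_extP => f_inj f_mono.
have [g fK gK] := inj_card_bij f_inj (eq_leq (card_ord _)).
pose p := [tuple g i | i < #|X|].
have indexE x : index x p = f x.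
  by rewrite -{1}(fK x) index_map ?index_enum_ord //; apply: can_inj gK.
have p_full x : x \in p by rewrite -index_mem indexE size_tuple.
exists p; last first.
  by apply/ffunP => x; apply/val_inj; rewrite [LHS]labellingE ?size_tuple.
apply/feasibleP; split=> [|x _|x y _ _ xy]; rewrite ?inE ?indexE ?f_mono //.
by rewrite map_inj_uniq ?enum_uniq //; apply: can_inj gK.
Qed.

Lemma labelling_inj (p q : #|X|.-tuple X) :
  feasible setT p -> feasible setT q -> labelling p = labelling q -> p = q.
Proof.
move=> p_feas q_feas pq; apply: eq_from_tnth => i; pose x := tnth p i.
have [p_uniq _ _] := feasibleP _ _ p_feas.
have xE : index x q = i.
  rewrite -labellingE -?pq ?labellingE ?feasible_full ?size_tuple //.
  by rewrite /x (tnth_nth x) index_uniq ?size_tuple.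
by rewrite [RHS](tnth_nth x) -xE nth_index ?feasible_full.
Qed.

Lemma card_lin_ext_words (E : pred {ffun X -> 'I_#|X|}) :
  #|[set f in lin_ext X | E f]|
    = num_words #|X| (setT : {set X}) (fun p => E (labelling p)).
Proof.
rewrite /num_words; set words := [set p : _.-tuple _ | _].
have <- : [set labelling (tval p) | p in words] = [set f in lin_ext X | E f].
  apply/setP => f; rewrite [RHS]inE; apply/imsetP/andP.
    case=> p; rewrite inE => /andP[p_feas Ep] ->; split=> //.
    exact: labelling_lin_ext.
  by case=> /lin_ext_labelling[p p_feas <-] Ep; exists p; rewrite // inE p_feas.
rewrite card_in_imset // => p q; rewrite !inE.
by move=> /andP[p_feas _] /andP[q_feas _]; apply: labelling_inj.
Qed.

Lemma fmin_gtP A f k :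
  reflect ((k < #|X|)%N /\ forall a, a \in A -> (k < pos f a)%N)
    (k < fmin A f)%N.
Proof. exact: (@bigmin_gtP _ nat). Qed.

Lemma fmin_labelling_gt A (p : #|X|.-tuple X) k : feasible setT p ->
  (k < fmin A (labelling p))%N = (k < #|X|)%N && avoids A k p.
Proof.
move=> p_feas.
have pos_gt a : (k < pos (labelling p) a)%N = (a \notin take k p).
  rewrite in_take ?feasible_full // -leqNgt /pos ltnS.
  by rewrite labellingE ?feasible_full ?size_tuple.
apply/fmin_gtP/andP => -[kX avoid]; split=> //; first apply/allP => a.
  by apply: contraTN => /avoid; rewrite pos_gt.
by move=> a aA; rewrite pos_gt; apply: contraL aA => /(allP avoid).
Qed.

Lemma card_fmin_gt A k :
  #|[set f in lin_ext X | (k < fmin A f)%N]|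
    = ((k < #|X|) * num_words #|X| (setT : {set X}) (avoids A k))%N.
Proof.
rewrite card_lin_ext_words -num_words_guard; apply: eq_card => p; rewrite !inE.
by apply: andb_id2l => p_feas; rewrite fmin_labelling_gt.
Qed.

Lemma card_lin_ext : #|lin_ext X| = num_ext #|X| (setT : {set X}).
Proof.
rewrite -[RHS](card_lin_ext_words predT).
by apply: eq_card => f; rewrite [RHS]inE andbT.
Qed.

Lemma card_fmin_gt_log_concave A : (1 < #|X|)%N ->
  (#|lin_ext X| * #|[set f in lin_ext X | (2 < fmin A f)%N]|
     <= #|[set f in lin_ext X | (1 < fmin A f)%N]| ^ 2)%N.
Proof.
move=> X1; have [n XE] : exists n, #|X| = n.+2.
  by case: #|X| X1 => [|[|n]] //; exists n.
have setTE : #|[set: X]| = n.+2 by rewrite cardsT.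
rewrite card_lin_ext !card_fmin_gt X1 mul1n XE.
apply: leq_trans (num_words_avoids_log_concave A setTE).
by rewrite leq_mul // -[leqRHS]mul1n leq_mul ?leq_b1.
Qed.

Lemma card_lin_ext_gt0 : (0 < #|lin_ext X|)%N.
Proof. by rewrite card_lin_ext num_ext_gt0 ?cardsT. Qed.

Lemma Pr_fmin_eq A k :
  Pr (fun f => fmin A f == k.+1)
    = Pr (fun f => (k < fmin A f)%N) - Pr (fun f => (k.+1 < fmin A f)%N).
Proof.
rewrite /Pr -mulrBl; congr (_ / _); apply/eqP.
rewrite eq_sym subr_eq -natrD eqr_nat.
rewrite -(cardsID [set f | fmin A f == k.+1]); apply/eqP.
congr (_ + _)%N; apply: eq_card => f; rewrite !inE.
  by case: eqP => [->|]; rewrite ?leqnn ?andbT ?andbF.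
by rewrite [(k.+1 < _)%N]ltn_neqAle eq_sym andbCA.
Qed.

Lemma Pr_fmin_gt0 A : (0 < #|X|)%N -> Pr (fun f => (0 < fmin A f)%N) = 1.
Proof.
move=> X0; have lin_ext_neq0 : #|lin_ext X|%:R != 0 :> rat.
  by rewrite pnatr_eq0 -lt0n card_lin_ext_gt0.
rewrite -[RHS](divff lin_ext_neq0); congr (_%:R / _); apply: eq_card => f.
by rewrite inE andb_idr // => _; apply/fmin_gtP; split.
Qed.

End LinearExtensions.

Theorem theorem1p6 (d : Order.disp_t) (X : finPOrderType d)
    (hX : (2 <= #|X|)%N) (A : {set X}) (hA : A != set0) :
  (Pr (fun f => (2 < fmin A f)%N) <= Pr (fun f => (1 < fmin A f)%N) ^+ 2)%R
  /\ (Pr (fun f => fmin A f == 1%N) * Pr (fun f => (1 < fmin A f)%N)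
      <= Pr (fun f => fmin A f == 2%N))%R.
Proof.
have gt2_le : Pr (fun f => 2 < fmin A f)%N <= Pr (fun f => 1 < fmin A f)%N ^+ 2.
  rewrite /Pr expr_div_n ler_pdivlMr ?exprn_gt0 ?ltr0n ?card_lin_ext_gt0 //.
  rewrite expr2 mulrA divfK ?pnatr_eq0 -?lt0n ?card_lin_ext_gt0 // mulrC.
  by rewrite -natrM -natrX ler_nat card_fmin_gt_log_concave.
split=> //; rewrite !Pr_fmin_eq Pr_fmin_gt0 1?ltnW //.
by rewrite mulrBl mul1r -expr2 lerB.
Qed.
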